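(* If $D$ is the distance matrix of a connected threshold graph, then the nullity of $D$ is at most $1$.
   Context: All graphs are finite and simple. A threshold graph is a graph containing no induced subgraph isomorphic to $2K_2$ (two disjoint edges), $P_4$ (path on 4 vertices) or $C_4$ (cycle on 4 vertices); equivalently, a graph obtainable from a single vertex by repeatedly adding an isolated vertex or a universal vertex. The distance matrix of a connected graph with vertices $v_1,\dots,v_n$ has $(i,j)$-entry the shortest-path distance between $v_i$ and $v_j$; the nullity is the dimension of its null space. *)

(* Defs.v *)
From mathcomp Require Import all_boot all_order all_algebra.

Set Implicit Arguments.
Unset Strict Implicit.
Unset Printing Implicit Defensive.

(* Graphs are given by their adjacency relation on a finite vertex type. *)

Definition simple_graph (T : finType) (e : rel T) : Prop :=
  symmetric e /\ irreflexive e.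

(* The null graph is not connected. *)
Definition connected_graph (T : finType) (e : rel T) : Prop :=
  0 < #|T| /\ forall x y : T, connect e x y.

Definition induced_subgraph (U T : finType) (h : rel U) (e : rel T) : Prop :=
  exists2 f : U -> T, injective f & forall i j, e (f i) (f j) = h i j.

(* Edges {0,1} and {2,3}. *)
Definition graph_2K2 : rel 'I_4 :=
  [rel i j : 'I_4 | (i != j) && (i./2 == j./2)].

Definition graph_P4 : rel 'I_4 :=
  [rel i j : 'I_4 | (j == i.+1 :> nat) || (i == j.+1 :> nat)].

Definition graph_C4 : rel 'I_4 :=
  [rel i j : 'I_4 | (j == i.+1 %% 4 :> nat) || (i == j.+1 %% 4 :> nat)].

Definition threshold_graph (T : finType) (e : rel T) : Prop :=
  [/\ ~ induced_subgraph graph_2K2 e,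
      ~ induced_subgraph graph_P4 e
    & ~ induced_subgraph graph_C4 e].

Definition walk_of_length (T : finType) (e : rel T) (x y : T) (k : nat) : bool :=
  [exists p : k.-tuple T, path e x p && (last x p == y)].

(* The least length of a walk from x to y. Lengths below #|T| suffice, by
   deleting loops; the value is #|T| if y is not reachable from x. *)
Definition graph_dist (T : finType) (e : rel T) (x y : T) : nat :=
  find (walk_of_length e x y) (iota 0 #|T|).

Lemma graph_dist_walk (T : finType) (e : rel T) (x y : T) :
  connect e x y ->
  exists p, [/\ path e x p, last x p = y & size p = graph_dist e x y].
Proof.
case/connectP=> p0 /shortenP [p ep up _] ->.
have szp : size p < #|T| by have := max_card (mem (x :: p)); rewrite (card_uniqP up).
have hasw : has (walk_of_length e x (last x p)) (iota 0 #|T|).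
  apply/hasP; exists (size p); first by rewrite mem_iota.
  by apply/existsP; exists (in_tuple p); rewrite ep eqxx.
have := nth_find 0 hasw; rewrite nth_iota ?add0n; last first.
  by rewrite -[X in _ < X](size_iota 0) -has_find.
case/existsP=> q /andP[eq /eqP lq].
by exists q; split=> //; rewrite size_tuple.
Qed.

Lemma graph_dist_min (T : finType) (e : rel T) (x : T) (p : seq T) :
  path e x p -> graph_dist e x (last x p) <= size p.
Proof.
move=> ep; rewrite leqNgt; apply/negP=> lt_p.
have := before_find 0 lt_p; rewrite nth_iota ?add0n; last first.
  by apply: leq_trans lt_p _; rewrite -[X in _ <= X](size_iota 0) find_size.
by move/negbT/negP; apply; apply/existsP; exists (in_tuple p); rewrite ep eqxx.
Qed.

Import GRing.Theory.
Local Open Scope ring_scope.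

Definition distance_matrix (R : numFieldType) (n : nat) (e : rel 'I_n) : 'M[R]_n :=
  \matrix_(i, j) (graph_dist e i j)%:R.

(* kermx is the left kernel, so the null space {x | A x = 0} is kermx A^T. *)
Definition nullity (R : fieldType) (m n : nat) (A : 'M[R]_(m, n)) : nat :=
  \rank (kermx A^T).

(* Main.v *)
Require Import Defs.
From mathcomp Require Import all_boot all_order all_algebra.

(** A connected threshold graph has a universal vertex, so its distances are at
    most 2 and D = 2 J - 2 I - A.  The coordinate sum is injective on the null
    space of D: if D x = 0 and the coordinates of x sum to 0, then
    (A + 2 I) x = 0.  Every nonempty vertex set of a threshold graph induces a
    subgraph with an isolated or universal vertex; at such a vertex v of the
    support of x the v-th equation reads 2 x_v = 0 or x_v = 0, so the support is
    empty. *)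

Set Implicit Arguments.
Unset Strict Implicit.
Unset Printing Implicit Defensive.

Import GRing.Theory Num.Theory.
Local Open Scope ring_scope.

Lemma induced_subgraph_4 (T : finType) (e : rel T) (h : rel 'I_4) (s : 4.-tuple T) :
  uniq s -> (forall i j, e (tnth s i) (tnth s j) = h i j) -> induced_subgraph h e.
Proof. by move=> /tuple_uniqP s_inj se; exists (tnth s). Qed.

Section Threshold.

Variables (T : finType) (e : rel T).
Hypotheses (e_simple : simple_graph e) (e_thr : threshold_graph e).

(* The pairs ad and bc are free: both, one or none of them being edges gives an
   induced C4, P4 or 2K2. *)
Lemma alternating_4cycle_free a b c d :
  e a b -> e c d -> ~~ e a c -> ~~ e b d -> a != c -> b != d -> False.
Proof.
case: e_simple e_thr => e_sym e_irr [no2K2 noP4 noC4] ab cd /negbTE nac /negbTE nbd.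
move=> neq_ac neq_bd.
have neqe x y z : e x y -> e z y = false -> x != z.
  by move=> xy; apply: contraFneq => <-.
have neq_ab : a != b by apply: neqe ab (e_irr b).
have neq_cd : c != d by apply: neqe cd (e_irr d).
have neq_ad : a != d by apply: neqe ab _; rewrite e_sym.
have neq_bc : b != c by apply: (@neqe _ a); rewrite e_sym.
have [ad|/negbTE nad] := boolP (e a d); have [bc|/negbTE nbc] := boolP (e b c).
- apply: noC4; apply: (@induced_subgraph_4 _ _ _ [tuple a; b; c; d]).
    by rewrite /= !inE !negb_or neq_ab neq_ac neq_ad neq_bc neq_bd neq_cd.
  by do 2![case=> [[|[|[|[|//]]]] ?]]; rewrite !(tnth_nth a) /= ?e_irr //;
    rewrite // e_sym.
- apply: noP4; apply: (@induced_subgraph_4 _ _ _ [tuple b; a; d; c]).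
    rewrite /= !inE !negb_or (eq_sym b a) neq_ab neq_bd neq_bc neq_ad neq_ac.
    by rewrite eq_sym neq_cd.
  by do 2![case=> [[|[|[|[|//]]]] ?]]; rewrite !(tnth_nth a) /= ?e_irr //;
    rewrite // e_sym.
- apply: noP4; apply: (@induced_subgraph_4 _ _ _ [tuple a; b; c; d]).
    by rewrite /= !inE !negb_or neq_ab neq_ac neq_ad neq_bc neq_bd neq_cd.
  by do 2![case=> [[|[|[|[|//]]]] ?]]; rewrite !(tnth_nth a) /= ?e_irr //;
    rewrite // e_sym.
- apply: no2K2; apply: (@induced_subgraph_4 _ _ _ [tuple a; b; c; d]).
    by rewrite /= !inE !negb_or neq_ab neq_ac neq_ad neq_bc neq_bd neq_cd.
  by do 2![case=> [[|[|[|[|//]]]] ?]]; rewrite !(tnth_nth a) /= ?e_irr //;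
    rewrite // e_sym.
Qed.

(** A vertex [v] of maximum degree inside [S] decides the case: if it misses some other [w] in [S],
    then [w] is isolated in [S], since an edge at [w] would produce a forbidden alternating
    4-cycle. *)
Lemma isolated_or_universal (S : {set T}) : S != set0 ->
  exists2 v, v \in S &
    {in S, forall w, ~~ e v w} \/ {in S, forall w, w != v -> e v w}.
Proof.
case: (e_simple) => e_sym e_irr /set0Pn[x0 Sx0].
pose N x := [set y in S | e x y].
case: (arg_maxnP (fun x => #|N x|) Sx0) => v vS v_max.
have {x0 Sx0 vS} Sv : v \in S by [].
have [/forall_inP univ|] := boolP [forall w in S, (w != v) ==> e v w].
  by exists v => //; right=> w /univ/implyP.
case/forall_inPn=> w Sw; rewrite negb_imply => /andP[neq_wv nvw].
exists w => //; left=> z Sz; apply/negP=> wz.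
have neq_vz : v != z by apply: contraNneq nvw => ->; rewrite e_sym.
(* Since deg z <= deg v, some neighbour y of v other than z is no neighbour of z;
   then wz and vy are edges while wv and zy are not. *)
have /subsetPn[y] : ~~ (N v :\ z \subset N z :\ v).
  apply/negP=> sub.
  have pr : N v :\ z \proper N z :\ v.
    apply/properP; split=> //; exists w; rewrite !inE Sw ?(negbTE nvw) ?andbF //.
    by rewrite neq_wv e_sym.
  have := v_max z Sz; rewrite /= (cardsD1 v (N z)) (cardsD1 z (N v)) !inE Sv Sz.
  by rewrite (e_sym z v) leq_add2l leqNgt proper_card.
rewrite !inE => /and3P[neq_yz Sy vy].
have neq_yv : y != v by apply: contraTneq vy => ->; rewrite e_irr.
rewrite Sy neq_yv /= => nzy.
apply: (alternating_4cycle_free wz vy _ nzy neq_wv _); first by rewrite e_sym.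
by rewrite eq_sym.
Qed.

(** The dichotomy is applied to the whole vertex set. In a connected graph an isolated vertex is the
    only vertex, hence vacuously universal. *)
Lemma universal_vertex : connected_graph e -> exists u, forall y, y != u -> e u y.
Proof.
case=> /card_gt0P[x0 _] conn.
have [|v _ [iso|univ]] := @isolated_or_universal setT.
- by apply/set0Pn; exists x0; rewrite inE.
- exists v => y; case/connectP: (conn v y) => [[|z p] /= ep ->]; first by rewrite eqxx.
  by case/andP: ep => vz _; have := iso z (in_setT z); rewrite vz.
- by exists v => y; apply: univ; rewrite inE.
Qed.

Lemma graph_distE x y : connected_graph e ->
  graph_dist e x y = if x == y then 0%N else if e x y then 1%N else 2.
Proof.
case: (e_simple) => e_sym e_irr conn.
have dist_le p : path e x p -> last x p = y -> (graph_dist e x y <= size p)%N.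
  by move=> ep <-; apply: graph_dist_min.
have [p [ep lp sp]] := graph_dist_walk (conn.2 x y).
apply/eqP; rewrite eqn_leq; have [eq_xy|neq_xy] := eqVneq x y.
  by rewrite (dist_le [::]).
have [xy|nxy] := boolP (e x y).
  rewrite (dist_le [:: y]) /= ?xy // -sp.
  by case: p lp {ep sp} => //= eq_xy; rewrite eq_xy eqxx in neq_xy.
(* For distinct non-adjacent [x] and [y], the shortest walk [p] can have neither 0 nor 1 steps. Both
   vertices differ from a universal vertex [u], so the walk through [u] gives the bound 2. *)
apply/andP; split; last first.
  rewrite -sp; case: p lp ep {sp} => [|z [|//]] /=.
    by move=> eq_xy; rewrite eq_xy eqxx in neq_xy.
  by move=> ->; rewrite (negbTE nxy).
have [u univ] := universal_vertex conn.
have neq_xu : x != u.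
  by apply: contraNneq nxy => eq_xu; rewrite eq_xu univ // -eq_xu eq_sym.
apply: (dist_le [:: u; y]) => //=; rewrite e_sym !univ //.
by apply: contraNneq nxy => ->; rewrite e_sym univ.
Qed.

Lemma adjacency_eigen_sum0 (R : numFieldType) (x : T -> R) :
  \sum_j x j = 0 -> (forall i, x i *+ 2 + \sum_(j | e i j) x j = 0) ->
  forall i, x i = 0.
Proof.
case: (e_simple) => e_sym e_irr sum0 eqx i.
pose S := [set j | x j != 0].
have notS j : j \notin S -> x j = 0 by rewrite inE negbK => /eqP.
apply: (notS); suff -> : S = set0 by rewrite inE.
apply/eqP/negPn/negP => /isolated_or_universal[v Sv].
have xv0 : x v != 0 by rewrite inE in Sv.
case=> [iso|univ]; case/negP: xv0; have := eqx v.
  rewrite big1 => [|j vj]; last by apply: notS; apply: contraL vj; apply: iso.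
  by rewrite addr0 => /eqP; rewrite mulrn_eq0.
(* Non-neighbours of [v] other than [v] lie outside the support [S] and contribute 0. As all
   coordinates sum to 0, the neighbour sum is [- x v], which leaves [x v = 0]. *)
have -> : \sum_(j | e v j) x j = \sum_(j | j != v) x j.
  rewrite big_mkcond [RHS]big_mkcond; apply: eq_bigr => j _.
  have [->|neq_jv] /= := eqVneq j v; first by rewrite e_irr.
  have [//|nvj] := boolP (e v j).
  by rewrite notS //; apply: contra nvj => Sj; apply: univ.
by rewrite mulr2n -addrA; move: sum0; rewrite (bigD1 v) //= => ->; rewrite addr0 => ->.
Qed.

End Threshold.

Theorem theorem9 (R : numFieldType) (n : nat) (e : rel 'I_n)
    (e_simple : simple_graph e) (e_conn : connected_graph e)
    (e_thr : threshold_graph e) :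
  (nullity (distance_matrix R e) <= 1)%N.
Proof.
set D := distance_matrix R e; pose c : 'cV[R]_n := const_mx 1.
(* Right multiplication by the all-ones column [c] is the coordinate sum. Trivial intersection makes
   it rank-preserving on [kermx D^T], and the product has a single column, so its rank is at most
   1. *)
have inj : (kermx D^T :&: kermx c)%MS == 0.
  apply/rowV0P=> x; rewrite sub_capmx => /andP[/sub_kermxP xD /sub_kermxP xc].
  have sum0 : \sum_j x 0 j = 0.
    have /matrixP/(_ 0 0) := xc; rewrite !mxE; apply: etrans.
    by apply: eq_bigr => j _; rewrite mxE mulr1.
  apply/rowP=> i; rewrite mxE.
  apply: (adjacency_eigen_sum0 e_simple e_thr sum0) => {}i.
  have /matrixP/(_ 0 i) := xD; rewrite !mxE => xDi.
  have : \sum_j x 0 j *+ 2 - (x 0 i *+ 2 + \sum_(j | e i j) x 0 j) = 0.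
    rewrite -[RHS]xDi (big_mkcond (e i)) -(big_pred1_eq +%R i (fun j => x 0 j *+ 2)).
    rewrite (big_mkcond (pred1 i)) -big_split -sumrB; apply: eq_bigr => j _ /=.
    rewrite !mxE (graph_distE e_simple e_thr) // eq_sym.
    have [<-|_] := eqVneq; first by rewrite e_simple.2 addr0 subrr mulr0.
    by case: (e i j); rewrite add0r ?mulr1 ?subr0 ?mulr_natr // mulr2n addrK.
  by rewrite sumrMnl sum0 mul0rn sub0r => /eqP; rewrite oppr_eq0 => /eqP.
rewrite /nullity; move/mxrank_injP: inj => <-.
exact: rank_leq_col.
Qed.
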